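(* Let $P$ be the condensation measure associated with the uniform distribution $\nu$ on $[\frac25,\frac35]$. Then $\lim_{n\to\infty}\frac{2\log n}{-\log V_n(P)}=1$, i.e., the quantization dimension $D(P)$ of the measure $P$ exists and equals the quantization dimension $D(\nu)$ of $\nu$.
   Context: Let $\nu$ be the uniform distribution on $[\frac25,\frac35]\subset\mathbb R$. Let $S_1(x)=\frac15x$ and $S_2(x)=\frac15x+\frac45$ for $x\in\mathbb R$. The condensation measure $P$ associated with $\nu$ is the unique Borel probability measure on $\mathbb R$ with $P=\frac13P\circ S_1^{-1}+\frac13P\circ S_2^{-1}+\frac13\nu$. For a Borel probability measure $\mu$ on $\mathbb R$ the $n$th quantization error (of order $2$) is $V_n(\mu)=\inf\{\int\min_{a\in\alpha}(x-a)^2\,d\mu(x):\alpha\subseteq\mathbb R,\ 1\le\mathrm{card}(\alpha)\le n\}$. The quantization dimension of $\mu$ (of order 2) is $D(\mu)=\lim_{n\to\infty}\frac{2\log n}{-\log V_n(\mu)}$, when the limit exists. *)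

(* Defs.v *)
(* The real line is an arbitrary R : realType; measurableTypeR R carries its
   Borel sigma-algebra. *)
From HB Require Import structures.
From mathcomp Require Import all_boot all_order all_algebra finmap.
From mathcomp Require Import all_classical all_reals all_analysis.
Set Implicit Arguments.
Unset Strict Implicit.
Unset Printing Implicit Defensive.
Import Order.TTheory GRing.Theory Num.Theory.
Import numFieldNormedType.Exports.
Local Open Scope classical_set_scope.
Local Open Scope ring_scope.

Lemma lt_2div5_3div5 (R : realType) : 2 / 5 < 3 / 5 :> R.
Proof. by rewrite ltr_pM2r ?invr_gt0 ?ltr0n// ltr_nat. Qed.

Definition nu (R : realType) : probability (measurableTypeR R) R :=
  uniform_prob (lt_2div5_3div5 R).

Definition S1 (R : realType) (x : measurableTypeR R) : measurableTypeR R :=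
  1 / 5 * x.

Definition S2 (R : realType) (x : measurableTypeR R) : measurableTypeR R :=
  1 / 5 * x + 4 / 5.

Definition condensation_measure (R : realType)
    (P : probability (measurableTypeR R) R) : Prop :=
  forall A : set (measurableTypeR R), measurable A ->
    P A = ((1 / 3)%:E * pushforward P (@S1 R) A
           + (1 / 3)%:E * pushforward P (@S2 R) A
           + (1 / 3)%:E * nu R A)%E.

(* The minimum is taken in \bar R, where +oo is neutral, so that for nonempty
   alpha it is the usual minimum over the points of alpha. *)
Definition distortion (R : realType) (mu : probability (measurableTypeR R) R)
    (alpha : {fset R}) : \bar R :=
  (\int[mu]_x \big[Order.min/+oo]_(a <- alpha) ((x - a) ^+ 2)%:E)%E.

Definition quantization_error (R : realType)
    (mu : probability (measurableTypeR R) R) (n : nat) : \bar R :=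
  ereal_inf [set distortion mu alpha | alpha in
    [set alpha : {fset R} | (1 <= #|` alpha| <= n)%N]].

(* The conventions fine +oo = 0, ln 0 = 0 and x / 0 = 0 give the value 0 when
   the error is 0 or +oo, in agreement with - log 0 = +oo and - log +oo = -oo. *)
Definition quantization_ratio (R : realType)
    (mu : probability (measurableTypeR R) R) (n : nat) : R :=
  2 * ln n%:R / - ln (fine (quantization_error mu n)).

(* Meaningful only when the sequence of ratios converges. *)
Definition quantization_dimension (R : realType)
    (mu : probability (measurableTypeR R) R) : R :=
  lim (quantization_ratio mu n @[n --> \oo]).

(* Main.v *)
Require Import Defs.
From HB Require Import structures.
From mathcomp Require Import all_boot all_order all_algebra finmap.
From mathcomp Require Import all_classical all_reals all_analysis.
From mathcomp Require Import measurable_realfun zify ring lra.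
Import Order.TTheory GRing.Theory Num.Theory.
Import numFieldNormedType.Exports.
Local Open Scope classical_set_scope.
Local Open Scope ring_scope.

(** Two-sided bounds c / n^2 <= V_n <= C / n^2, for n >= 1, give the limit 1 at
once, because then - ln V_n = 2 ln n + O(1) while ln n tends to infinity
(cvg_quantization_ratio). Both P and nu satisfy such bounds.

The lower bound holds for every probability measure mu with mu >= nu / 3, and
this covers P and nu together (quantization_error_ge). Since nu has density at
most 5, the points within distance 1 / (20 n) of a set of n points have
nu-measure at most 1/2, so mu gives the points further away at least the mass
1/6, and each of them contributes at least 1 / (20 n)^2.

The upper bound for nu comes from n equally spaced points. For P it is first
proved along the powers of 4 (exists_seq_geometric_distortion): V_(4^j)(P) is at
most 16^(-j). If s has at most 4^j points, then S1(s), S2(s) and 2 * 4^j equally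
spaced points of [2/5, 3/5] together have at most 4^(j+1) points. The identity
defining P splits the integral into three parts; S1 and S2 contract squared
distances by 1/25, so the new distortion is at most
  (2/75) V + (1/3) (1/100) 16^(-j),
where V <= 16^(-j) is the distortion of s. This is below 16^(-(j+1)) because
2/75 + 1/300 < 1/16: each of the two similar copies receives only a quarter
of the points, but 2/75 < 1/16, so the nu-part governs the rate. The
induction starts because the one-point set {0} has distortion at most 1, as P
is carried by [-1, 1] (condensation_carrier). *)

(** * Squared distance to a finite set *)

(** The integrand of the distortion, over a sequence instead of a finite set: it
can then be treated by induction, and repeated points do no harm. *)
Definition min_sqdist {R : realType} (s : seq R) (x : measurableTypeR R) :
    \bar R :=
  (\big[Order.min/+oo]_(a <- s) ((x - a) ^+ 2)%:E)%E.

Section MinSqdist.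
Context {R : realType}.
Implicit Types (s : seq R) (x : R).

Lemma min_sqdist_cons a s x :
  min_sqdist (a :: s) x = Order.min ((x - a) ^+ 2)%:E (min_sqdist s x).
Proof. by rewrite /min_sqdist big_cons. Qed.

Lemma min_sqdist_ge0 s x : (0 <= min_sqdist s x)%E.
Proof.
elim: s => [|a s IH]; first by rewrite /min_sqdist big_nil.
by rewrite min_sqdist_cons le_min IH lee_fin sqr_ge0.
Qed.

Lemma min_sqdist_le s a x : a \in s -> (min_sqdist s x <= ((x - a) ^+ 2)%:E)%E.
Proof.
elim: s => // b s IH; rewrite inE min_sqdist_cons ge_min => /orP[/eqP<-|/IH ->].
  by rewrite lexx.
by rewrite orbT.
Qed.

Lemma le_min_sqdist s x (c : \bar R) :
  (forall a, a \in s -> (c <= ((x - a) ^+ 2)%:E)%E) -> (c <= min_sqdist s x)%E.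
Proof.
elim: s => [|b s IH] h; first by rewrite /min_sqdist big_nil leey.
rewrite min_sqdist_cons le_min h ?mem_head//=; apply: IH => a sa.
by apply: h; rewrite inE sa orbT.
Qed.

Lemma measurable_sqr_sub (a : R) :
  measurable_fun [set: measurableTypeR R]
    (fun x : measurableTypeR R => ((x - a) ^+ 2)%:E).
Proof.
apply/measurable_EFinP; apply: measurable_funX.
by apply: measurable_funB => //; exact: measurable_id.
Qed.

Lemma measurable_min_sqdist s :
  measurable_fun [set: measurableTypeR R] (min_sqdist s).
Proof.
elim: s => [|a s IH].
  have -> : min_sqdist (Nil R) = cst +oo%E.
    by apply/funext => x; rewrite /min_sqdist big_nil.
  exact: measurable_cst.
have -> : min_sqdist (a :: s) =
    (fun x => Order.min ((x - a) ^+ 2)%:E (min_sqdist s x)).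
  by apply/funext => x; rewrite min_sqdist_cons.
by apply: measurable_mine IH; exact: measurable_sqr_sub.
Qed.

(** This is an equality when t is the image of s; the inequality allows t to
contain the points that serve the rest of the measure. *)
Lemma min_sqdist_similarity (s t : seq R) (S : R -> R) (x : R) :
  (forall x y, S x - S y = 5^-1 * (x - y)) -> {subset map S s <= t} ->
  (min_sqdist t (S x) <= 25^-1%:E * min_sqdist s x)%E.
Proof.
move=> SE st; rewrite -lee_pdivrMl//; apply: le_min_sqdist => a sa.
rewrite lee_pdivrMl//; apply: (le_trans (min_sqdist_le _ (S a) _ _)).
  by apply: st; exact: map_f.
by rewrite SE exprMn -EFinM lee_fin; lra.
Qed.

Lemma integral_similarity_le (mu : probability (measurableTypeR R) R)
    (s t : seq R) (S : measurableTypeR R -> measurableTypeR R) :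
  measurable_fun setT S ->
  (forall x y, S x - S y = 5^-1 * (x - y)) -> {subset map S s <= t} ->
  (\int[mu]_x min_sqdist t (S x) <= 25^-1%:E * \int[mu]_x min_sqdist s x)%E.
Proof.
move=> mS SE st; rewrite -ge0_integralZl//; last 2 first.
- exact: measurable_min_sqdist.
- by move=> x _; exact: min_sqdist_ge0.
apply: ge0_le_integral => //.
- by move=> x _; exact: min_sqdist_ge0.
- by apply: measurableT_comp mS; exact: measurable_min_sqdist.
- by apply: measurable_funeM; exact: measurable_min_sqdist.
- by move=> x _; exact: min_sqdist_similarity.
Qed.

End MinSqdist.

(** * Integrals over a carrier *)

Lemma integral_le_cst_carrier d (T : measurableType d) (R : realType)
    (mu : probability T R) (E : set T) (f : T -> \bar R) (c : R) :
  measurable E -> mu (~` E) = 0%E -> measurable_fun setT f ->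
  (forall x, 0 <= f x)%E -> 0 <= c -> (forall x, E x -> (f x <= c%:E)%E) ->
  (\int[mu]_x f x <= c%:E)%E.
Proof.
move=> mE mu0 mf f0 c0 fc.
rewrite -[leRHS]mule1 -(probability_setT mu) -integral_cst//.
apply: ae_ge0_le_integral => //.
exists (~` E); split => //; first exact: measurableC.
by move=> x /= nfc Ex; apply: nfc => _; exact: fc.
Qed.

(** * The uniform distribution *)

Section Nu.
Context {R : realType}.

Lemma nu_carrier : nu R (~` `[2 / 5, 3 / 5]%classic) = 0%E.
Proof.
rewrite probability_setC//.
have -> : nu R `[2 / 5, 3 / 5]%classic = 1%E.
  by apply: integral_uniform_pdf1 => //; exact: lt_2div5_3div5.
by rewrite subee.
Qed.

Lemma nu_le_lebesgue (A : set (measurableTypeR R)) : measurable A ->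
  (nu R A <= 5%:E * lebesgue_measure A)%E.
Proof.
move=> mA; rewrite -integral_cst//.
apply: ge0_le_integral => //.
- by move=> x _; rewrite lee_fin uniform_pdf_ge0// lt_2div5_3div5.
- by apply/measurable_EFinP/measurable_funTS; exact: measurable_uniform_pdf.
- move=> x _; rewrite lee_fin /uniform_pdf; case: ifPn => // _.
  have -> : (3 / 5 - 2 / 5)^-1 = 5 :> R by field.
  exact: lexx.
Qed.

(** The set is the union of the intervals of length 2 r around the points of s,
and nu has density at most 5. *)
Lemma nu_near_seq_le (s : seq R) (r : R) : 0 < r ->
  (nu R [set x | (min_sqdist s x < (r ^+ 2)%:E)%E]
   <= ((size s)%:R * (10 * r))%:E)%E.
Proof.
move=> r0.
have msub (t : seq R) : measurable [set x | (min_sqdist t x < (r ^+ 2)%:E)%E].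
  rewrite -[X in measurable X]setTI; apply: emeasurable_fun_lt => //.
  exact: measurable_min_sqdist.
elim: s => [|a s IH].
  rewrite [X in nu R X](_ : _ = set0) ?measure0 ?mul0r//.
  by rewrite -subset0 => x /=; rewrite /min_sqdist big_nil.
have -> : [set x | (min_sqdist (a :: s) x < (r ^+ 2)%:E)%E] =
    `]a - r, a + r[%classic `|` [set x | (min_sqdist s x < (r ^+ 2)%:E)%E].
  apply/seteqP; split => x /=; rewrite min_sqdist_cons gt_min lte_fin in_itv/=.
    move=> /orP[|]; last by right.
    move=> h; left; rewrite -ltr_distl -(ltr_pXn2r (n := 2))// ?nnegrE ?ltW//.
    by rewrite real_normK// num_real.
  move=> [|->]; last by rewrite orbT.
  rewrite -ltr_distl => h; apply/orP; left.
  by rewrite -real_normK ?num_real// ltr_pXn2r// nnegrE ltW.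
have -> : (size (a :: s))%:R * (10 * r) = 10 * r + (size s)%:R * (10 * r).
  by rewrite /= -add1n natrD mulrDl mul1r.
apply: le_trans (measureU2 _ _ _) _ => //.
rewrite EFinD leeD//.
apply: le_trans (nu_le_lebesgue _ _) _ => //.
rewrite lebesgue_measure_itv/= lte_fin.
have -> : a - r < a + r by lra.
by rewrite -EFinD -EFinM lee_fin; lra.
Qed.

End Nu.

(** * Lower bound on the quantization error *)

Section LowerBound.
Context {R : realType} (mu : probability (measurableTypeR R) R).
Hypothesis nu_le : forall A, measurable A -> (3^-1%:E * nu R A <= mu A)%E.

(** Markov's inequality for the squared distance to the code points: the radius
1 / (20 n) makes the neighbourhood of any n points have nu-measure at most 1/2. *)
Lemma quantization_error_ge n : (0 < n)%N ->
  (((6 * 20 ^+ 2)^-1 / n%:R ^+ 2)%:E <= quantization_error mu n)%E.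
Proof.
move=> n0; have n0' : 0 < n%:R :> R by rewrite ltr0n.
apply: le_ereal_inf_tmp => _ /= [alpha /andP[_ an] <-].
pose r : R := (20 * n%:R)^-1.
have r0 : 0 < r by rewrite invr_gt0 mulr_gt0.
pose F := [set x | (min_sqdist alpha x < (r ^+ 2)%:E)%E].
have mF : measurable F.
  rewrite -[X in measurable X]setTI; apply: emeasurable_fun_lt => //.
  exact: measurable_min_sqdist.
have nuF : (nu R F <= (2^-1)%:E)%E.
  apply: le_trans (nu_near_seq_le _ _ r0) _; rewrite lee_fin.
  have -> : 2^-1 = n%:R * (10 * r) :> R by rewrite /r; field; rewrite gt_eqF.
  by rewrite ler_pM2r ?ler_nat// mulr_gt0.
have nuFC : ((2^-1)%:E <= nu R (~` F))%E.
  rewrite probability_setC// leeBrDr ?fin_num_measure//.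
  apply: le_trans (leeD2l _ nuF) _; rewrite -EFinD lee_fin; lra.
have muFC : ((6^-1)%:E <= mu (~` F))%E.
  apply: le_trans (nu_le _ (measurableC mF)).
  apply: le_trans (lee_pmul _ _ (lexx _) nuFC) => //.
  by rewrite -EFinM lee_fin; lra.
have := le_integral_abse mu measurableT (measurable_min_sqdist alpha)
  (exprn_gt0 2 r0).
have -> : (\int[mu]_x `|min_sqdist alpha x|)%E = distortion mu alpha.
  by apply: eq_integral => x _; rewrite gee0_abs// min_sqdist_ge0.
apply: le_trans.
have -> : setT `&` [set x | ((r ^+ 2)%:E <= `|min_sqdist alpha x|)%E] = ~` F.
  rewrite setTI; apply/seteqP; split => x /=;
    rewrite gee0_abs ?min_sqdist_ge0// leNgt; by move/negP.
apply: le_trans (lee_pmul _ _ (lexx _) muFC) => //; last first.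
- by rewrite lee_fin sqr_ge0.
- rewrite -EFinM lee_fin /r le_eqVlt; apply/orP; left; apply/eqP.
  by field; rewrite gt_eqF.
Qed.

End LowerBound.

(** * Upper bound for the uniform distribution *)

Section Grid.
Context {R : realType}.

(** The left endpoints of the k subintervals of equal length of [2/5, 3/5]. *)
Definition grid k : seq R := [seq 2 / 5 + i%:R / (5 * k%:R) | i <- iota 0 k].

Lemma size_grid k : size (grid k) = k.
Proof. by rewrite size_map size_iota. Qed.

(** The integer part of t would do except at t = k, which is not an admissible
index; the non-strict bound 1 lets k - 1 serve there. *)
Lemma near_natural k (t : R) : (0 < k)%N -> 0 <= t <= k%:R ->
  exists2 i, (i < k)%N & `|t - i%:R| <= 1.
Proof.
elim: k => // -[|k] IH _ /andP[t0 tk].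
  by exists 0 => //; rewrite subr0 ger0_norm.
have [tk'|tk'] := leP t k.+1%:R.
  have [//||i ik ti] := IH; first by rewrite t0.
  by exists i => //; rewrite ltnS ltnW.
exists k.+1 => //.
rewrite ger0_norm; last by rewrite subr_ge0 ltW.
by rewrite lerBlDr -natr1 addrC in tk *.
Qed.

Lemma grid_near k (x : R) : (0 < k)%N -> 2 / 5 <= x <= 3 / 5 ->
  exists2 a, a \in grid k & (x - a) ^+ 2 <= (25 * k%:R ^+ 2)^-1.
Proof.
move=> k0 /andP[x2 x3]; have k0' : 0 < k%:R :> R by rewrite ltr0n.
have [//||i ik xi] := near_natural k (5 * k%:R * (x - 2 / 5)).
  by apply/andP; split; nra.
exists (2 / 5 + i%:R / (5 * k%:R)).
  by apply/mapP; exists i => //; rewrite mem_iota.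
have -> : (x - (2 / 5 + i%:R / (5 * k%:R))) ^+ 2 =
    (5 * k%:R * (x - 2 / 5) - i%:R) ^+ 2 * (25 * k%:R ^+ 2)^-1.
  by field; rewrite gt_eqF.
rewrite ler_piMl// ?invr_ge0 ?mulr_ge0 ?sqr_ge0//.
by rewrite -real_normK ?num_real// expr_le1.
Qed.

(** Allowing s to be larger than the grid is what the self-similar construction
needs, where the grid is only one of three parts. *)
Lemma integral_nu_min_sqdist_le k (s : seq R) : (0 < k)%N ->
  {subset grid k <= s} ->
  (\int[nu R]_x min_sqdist s x <= ((25 * k%:R ^+ 2)^-1)%:E)%E.
Proof.
move=> k0 gs.
apply: (integral_le_cst_carrier _ _ _ (nu R) `[2 / 5, 3 / 5]%classic) => //.
- exact: nu_carrier.
- exact: measurable_min_sqdist.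
- by move=> x; exact: min_sqdist_ge0.
- move=> x /=; rewrite in_itv/= => /(grid_near _ _ k0)[a ga xa].
  by apply: le_trans (min_sqdist_le _ _ _ (gs _ ga)) _; rewrite lee_fin.
Qed.

End Grid.

Lemma quantization_error_le_seq {R : realType}
    (mu : probability (measurableTypeR R) R) (s : seq R) n :
  (0 < size s <= n)%N ->
  (quantization_error mu n <= \int[mu]_x min_sqdist s x)%E.
Proof.
move=> /andP[s0 sn].
have -> : (\int[mu]_x min_sqdist s x = distortion mu [fset x in s]%fset)%E.
  apply: eq_integral => x _; apply/eqP; rewrite eq_le; apply/andP; split.
    apply: (@le_min_sqdist R [fset x in s]%fset) => a; rewrite inE.
    exact: min_sqdist_le.
  apply: le_min_sqdist => a sa.
  by apply: (@min_sqdist_le R [fset x in s]%fset); rewrite inE.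
apply: ereal_inf_lbound; exists [fset x in s]%fset => //=.
rewrite card_fseq (leq_trans (size_undup s) sn) andbT.
case: s s0 {sn} => // a s _; rewrite lt0n size_eq0.
by apply/eqP => /(congr1 (fun t => a \in t)); rewrite mem_undup mem_head.
Qed.

Lemma quantization_error_nu_le {R : realType} n : (0 < n)%N ->
  (quantization_error (nu R) n <= (1 / n%:R ^+ 2)%:E)%E.
Proof.
move=> n0; have n0' : 0 < n%:R :> R by rewrite ltr0n.
apply: le_trans (quantization_error_le_seq _ (grid n) _ _) _.
  by rewrite size_grid n0 leqnn.
apply: le_trans (integral_nu_min_sqdist_le _ _ n0 _) _ => //.
rewrite lee_fin invfM div1r ler_piMl ?invr_ge0 ?sqr_ge0//; lra.
Qed.

(** * From the order of the error to the dimension *)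

Section Asymptotics.
Context {R : realType}.

Lemma cvg_ln_natr : ln (n%:R : R) @[n --> \oo] --> +oo.
Proof.
apply/cvgryPge => A; near=> n.
rewrite -[A]expRK ler_ln ?posrE ?expR_gt0//; last first.
  by rewrite ltr0n; near: n; exact: nbhs_infty_gt.
by near: n; exact: nbhs_infty_ger.
Unshelve. all: by end_near. Qed.

(** The inverse of the ratio is 1 - e_n / (2 ln n), where e_n = ln (n^2 V_n) lies
between ln c and ln C. *)
Lemma cvg_quantization_ratio (mu : probability (measurableTypeR R) R) (c C : R) :
  0 < c ->
  (forall n, (0 < n)%N -> ((c / n%:R ^+ 2)%:E <= quantization_error mu n)%E) ->
  (forall n, (0 < n)%N -> (quantization_error mu n <= (C / n%:R ^+ 2)%:E)%E) ->
  quantization_ratio mu n @[n --> \oo] --> (1 : R).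
Proof.
move=> c0 lo up.
pose L (n : nat) : R := ln n%:R.
have cvgLV (M : R) : M * (2 * L n)^-1 @[n --> \oo] --> (0 : R).
  have LV : (L n)^-1 @[n --> \oo] --> (0 : R).
    apply/gtr0_cvgV0; last exact: cvg_ln_natr.
    by near=> n; apply: ln_gt0; rewrite ltr1n; near: n; exact: nbhs_infty_gt.
  under eq_fun do rewrite invfM mulrA.
  by rewrite -(mulr0 (M * 2^-1)); apply: cvgM LV; exact: cvg_cst.
have over1 M : 1 - M / (2 * L n) @[n --> \oo] --> (1 : R).
  by have := cvgB (cvg_cst (1 : R)) (cvgLV M); rewrite subr0; apply.
have : (- ln (fine (quantization_error mu n))) / (2 * L n) @[n --> \oo] --> (1 : R).
  apply: (@squeeze_cvgr _ _ _ _ (fun n => 1 - ln C * (2 * L n)^-1)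
    (fun n => 1 - ln c * (2 * L n)^-1)).
  - near=> n.
    have n1 : (1 < n)%N by near: n; exact: nbhs_infty_gt.
    have n0 : (0 < n)%N by exact: ltnW.
    have n0' : 0 < n%:R :> R by rewrite ltr0n.
    have L0 : 0 < L n by apply: ln_gt0; rewrite ltr1n.
    have [v vE] : exists v : R, quantization_error mu n = v%:E.
      have := lo _ n0; have := up _ n0.
      by case: (quantization_error mu n) => // v _ _; exists v.
    rewrite vE /=; have := lo _ n0; have := up _ n0; rewrite vE !lee_fin => vC cv.
    have cn0 : 0 < c / n%:R ^+ 2 by rewrite divr_gt0// exprn_gt0.
    have v0 : 0 < v by exact: lt_le_trans cv.
    have Cn0 : 0 < C / n%:R ^+ 2 by exact: lt_le_trans vC.
    have C0 : 0 < C by rewrite pmulr_lgt0 ?invr_gt0 ?exprn_gt0// in Cn0.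
    have lnE (x : R) : 0 < x -> ln (x / n%:R ^+ 2) = ln x - 2 * L n.
      move=> x0; rewrite ln_div ?posrE ?exprn_gt0// lnXn//.
      by rewrite mulr_natl.
    have lnC : ln v <= ln C - 2 * L n by rewrite -lnE// ler_ln ?posrE.
    have lnc : ln c - 2 * L n <= ln v by rewrite -lnE// ler_ln ?posrE.
    have L2 : 0 < 2 * L n by rewrite mulr_gt0.
    have over a : 1 - a / (2 * L n) = (2 * L n - a) / (2 * L n).
      by rewrite mulrBl mulfV// gt_eqF.
    rewrite !over !ler_pM2r ?invr_gt0//.
    by apply/andP; split; lra.
  - exact: over1.
  - exact: over1.
move=> /(cvgV (oner_neq0 _)); rewrite invr1.
have -> : quantization_ratio mu =
    (fun n => (- ln (fine (quantization_error mu n)) / (2 * L n))^-1).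
  by apply/funext => n; rewrite invf_div.
by [].
Unshelve. all: by end_near. Qed.

End Asymptotics.

(** * Upper bound for the condensation measure *)

Section Condensation.
Context {R : realType} (P : probability (measurableTypeR R) R).
Hypothesis hP : condensation_measure P.

Lemma measurable_S1 : measurable_fun setT (@S1 R).
Proof. by apply: measurable_funM => //; exact: measurable_id. Qed.

Lemma measurable_S2 : measurable_fun setT (@S2 R).
Proof. by apply: measurable_funD => //; exact: measurable_S1. Qed.

Lemma integral_condensation (f : measurableTypeR R -> \bar R) :
  measurable_fun setT f -> (forall x, 0 <= f x)%E ->
  (\int[P]_x f x = 3^-1%:E * \int[P]_x f (S1 x) + 3^-1%:E * \int[P]_x f (S2 x)
     + 3^-1%:E * \int[nu R]_x f x)%E.
Proof.
move=> mf f0.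
(* The pushforward is a measure only for a measurable map, so the proof of
   measurability is passed to the instance by hand. *)
pose m1 := measure_function_pushforward__canonical__measure_function_Measure
  P measurable_S1.
pose m2 := measure_function_pushforward__canonical__measure_function_Measure
  P measurable_S2.
have k0 : 0 <= 3^-1 :> R by [].
pose m := measure_add (measure_add (mscale (NngNum k0) m1) (mscale (NngNum k0) m2))
  (mscale (NngNum k0) (nu R)).
rewrite (eq_measure_integral m); last first.
  move=> A mA _; rewrite [LHS](hP A mA) !div1r.
  by rewrite [RHS]measure_addE; congr adde; rewrite [RHS]measure_addE.
rewrite !ge0_integral_measure_add// !ge0_integral_mscale//=.
by rewrite !ge0_integral_pushforward// ?preimage_setT//;
  [exact: measurable_S2|exact: measurable_S1].
Qed.

(** S1, S2 map [-1, 1] into itself and nu is carried by it, so the mass p of the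
complement satisfies p <= (2/3) p. *)
Lemma condensation_carrier : P (~` `[-1, 1]%classic) = 0%E.
Proof.
set E := ~` _.
have mE : measurable E by exact: measurableC.
have sub (S : measurableTypeR R -> measurableTypeR R) : measurable_fun setT S ->
    (forall x, `[-1, 1]%classic x -> `[-1, 1]%classic (S x)) ->
    (pushforward P S E <= P E)%E.
  move=> mS SE; apply: (le_measure P); rewrite ?inE//.
    by rewrite -[X in measurable X]setTI; exact: mS.
  by move=> x /= nSx Ex; apply: nSx; exact: SE.
have nuE : nu R E = 0%E.
  apply/eqP; rewrite -measure_le0 -nu_carrier; apply: le_measure; rewrite ?inE//.
    exact: measurableC.
  move=> x /= nx nux; apply: nx; move: nux.
  rewrite /= !in_itv/= => /andP[x2 x3]; apply/andP; split; lra.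
have : (P E <= (2 / 3)%:E * P E)%E.
  rewrite {1}hP// nuE mule0 adde0.
  have -> : (2 / 3)%:E = ((1 / 3)%:E + (1 / 3)%:E)%E :> \bar R.
    by rewrite -EFinD; congr EFin; lra.
  rewrite ge0_muleDl// leeD// lee_pmul2l//.
  - apply: sub => [|x/=]; first exact: measurable_S1.
    rewrite !in_itv/= /S1 => /andP[? ?]; apply/andP; split; lra.
  - apply: sub => [|x/=]; first exact: measurable_S2.
    rewrite !in_itv/= /S2 => /andP[? ?]; apply/andP; split; lra.
have [p pE] : exists p, P E = p%:E.
  by exists (fine (P E)); rewrite fineK// fin_num_measure.
have : (0 <= P E)%E by [].
rewrite pE -EFinM !lee_fin => p0 pp.
by congr EFin; lra.
Qed.

(** The similar copies of s and a grid of 2 * 4^j points make up the 4^(j+1) points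
of the next step; 2/75 + 1/300 < 1/16 closes the induction. *)
Lemma exists_seq_geometric_distortion j : exists2 s : seq R, (0 < size s <= 4 ^ j)%N &
  (\int[P]_x min_sqdist s x <= (16^-1 ^+ j)%:E)%E.
Proof.
elim: j => [|j [s /andP[s0 sj] IH]].
  exists [:: 0] => //.
  apply: (integral_le_cst_carrier _ _ _ P `[-1, 1]%classic) => //.
  - exact: condensation_carrier.
  - exact: measurable_min_sqdist.
  - by move=> x; exact: min_sqdist_ge0.
  - move=> x /=; rewrite in_itv/= => x1; apply: le_trans (min_sqdist_le _ 0 _ _) _.
      by rewrite mem_head.
    by rewrite lee_fin expr0 subr0 -real_normK ?num_real// expr_le1// ler_norml.
pose k := (2 * 4 ^ j)%N.
have k0 : (0 < k)%N by rewrite muln_gt0 expn_gt0.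
exists (map (@S1 R) s ++ map (@S2 R) s ++ grid k).
  rewrite !size_cat size_grid !size_map addn_gt0 s0/= expnS /k.
  have count (p q : nat) : (p <= q)%N -> (p + (p + 2 * q) <= 4 * q)%N by lia.
  exact: count.
set t := _ ++ _.
rewrite integral_condensation; last 2 first.
- exact: measurable_min_sqdist.
- by move=> x; exact: min_sqdist_ge0.
have h1 : (\int[P]_x min_sqdist t (S1 x) <= (25^-1 * 16^-1 ^+ j)%:E)%E.
  apply: le_trans (integral_similarity_le P s t _ measurable_S1 _ _) _.
  - by move=> x y; rewrite /S1; lra.
  - by move=> x; rewrite mem_cat => ->.
  - by rewrite EFinM lee_pmul2l.
have h2 : (\int[P]_x min_sqdist t (S2 x) <= (25^-1 * 16^-1 ^+ j)%:E)%E.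
  apply: le_trans (integral_similarity_le P s t _ measurable_S2 _ _) _.
  - by move=> x y; rewrite /S2; lra.
  - by move=> x xs; rewrite !mem_cat xs orbT.
  - by rewrite EFinM lee_pmul2l.
have h3 : (\int[nu R]_x min_sqdist t x <= (100^-1 * 16^-1 ^+ j)%:E)%E.
  apply: le_trans (integral_nu_min_sqdist_le k t k0 _) _.
    by move=> x xs; rewrite !mem_cat xs !orbT.
  rewrite lee_fin /k natrM natrX exprMn -exprM mulnC exprM exprVn.
  have -> : 4%:R ^+ 2 = 16 :> R by ring.
  by rewrite le_eqVlt; apply/orP; left; apply/eqP; field; rewrite expf_neq0.
have third (x y : \bar R) : (x <= y -> 3^-1%:E * x <= 3^-1%:E * y)%E.
  by rewrite lee_pmul2l.
apply: le_trans (leeD (leeD (third _ _ h1) (third _ _ h2)) (third _ _ h3)) _.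
rewrite -!EFinM -!EFinD lee_fin exprS.
have : 0 <= 16^-1 ^+ j :> R by rewrite exprn_ge0.
lra.
Qed.

(** The largest power 4^j <= n satisfies n < 4^(j+1), hence 16^(-j) <= 16 / n^2. *)
Lemma quantization_error_condensation_le n : (0 < n)%N ->
  (quantization_error P n <= (16 / n%:R ^+ 2)%:E)%E.
Proof.
move=> n0; have n0' : 0 < n%:R :> R by rewrite ltr0n.
have /andP[jn nj] := trunc_log_bounds (isT : 1 < 4)%N n0.
set j := trunc_log 4 n in jn nj.
have [s /andP[s0 sj] hs] := exists_seq_geometric_distortion j.
apply: le_trans (quantization_error_le_seq _ s _ _) _.
  by rewrite s0 (leq_trans sj).
apply: le_trans hs _; rewrite lee_fin ler_pdivlMr ?exprn_gt0//.
rewrite exprVn mulrC ler_pdivrMr ?exprn_gt0// -exprS.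
have -> : 16 = 4%:R ^+ 2 :> R by ring.
by rewrite -exprM mulnC exprM lerXn2r// ?nnegrE// -natrX ler_nat ltnW.
Qed.

End Condensation.

Theorem theorem4p11p1 (R : realType) (P : probability (measurableTypeR R) R)
    (hP : condensation_measure P) :
  [/\ quantization_ratio P n @[n --> \oo] --> (1 : R),
      cvg (quantization_ratio P n @[n --> \oo]),
      cvg (quantization_ratio (nu R) n @[n --> \oo]) &
      quantization_dimension P = quantization_dimension (nu R)].
Proof.
have c0 : 0 < (6 * 20 ^+ 2)^-1 :> R by rewrite invr_gt0 mulr_gt0// exprn_gt0.
have cP : quantization_ratio P n @[n --> \oo] --> (1 : R).
  apply: (cvg_quantization_ratio P _ 16 c0) => n n0.
    apply: quantization_error_ge n0 => A mA.
    rewrite hP// !div1r; apply: leeDr.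
    by apply: adde_ge0; apply: mule_ge0; rewrite ?lee_fin// /pushforward.
  exact: (quantization_error_condensation_le P hP n n0).
have cnu : quantization_ratio (nu R) n @[n --> \oo] --> (1 : R).
  apply: (cvg_quantization_ratio (nu R) _ 1 c0) => n n0.
    apply: quantization_error_ge n0 => A mA.
    by apply: gee_pMl => //; rewrite lee_fin; lra.
  exact: quantization_error_nu_le.
split; [exact: cP|by apply/cvg_ex; exists 1|by apply/cvg_ex; exists 1|].
by rewrite /quantization_dimension (cvg_lim _ cP)// (cvg_lim _ cnu).
Qed.
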